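(* Let $\mathcal{S}$ be the class of simple combinatorial auctions defined in the context, and call an auction in $\mathcal{S}$ convex if its payment function is a convex combination of the bids. For every convex auction in $\mathcal{S}$, the pure liquid price of stability of the auction over games in which all players have (monotone) subadditive valuation functions is at most $2$, and this bound is tight, i.e. this pure liquid price of stability equals $2$.
   Context: Setting: $m$ items are allocated to $n$ players. Player $i$ has a valuation function $v_i:2^{[m]}\to\mathbb{R}_{\ge 0}$ and a private budget $c_i\in\mathbb{R}_{\ge 0}$. A valuation $v_i$ is monotone if $S\subseteq T$ implies $v_i(S)\le v_i(T)$, and subadditive if $v_i(S\cup T)\le v_i(S)+v_i(T)$ for all $S,T\subseteq[m]$. All valuations are assumed monotone and subadditive. Class $\mathcal{S}$: each player $i$ submits bids $\mathbf{b}_i=(b_{ij})_{j\in[m]}$, $b_{ij}\ge 0$; $\mathbf{b}=(\mathbf{b}_i)_{i\in[n]}$ and $\mathbf{b}_{[j]}=(b_{ij})_{i\in[n]}$. An auction in $\mathcal{S}$ allocates each item $j$ independently to a player $\pi(j)$ with the highest bid for it ($b_{\pi(j),j}\ge b_{ij}$ for all $i$; items for which several players have the highest bid are given arbitrarily to one of these players), and charges $\pi(j)$ a payment $p_j(\mathbf{b}_{[j]})\in[0,b_{\pi(j),j}]$, where $p_j$ is non-decreasing and continuous in every bid. In a convex auction, $p_j(\mathbf{b}_{[j]})$ is a convex combination of the bids for item $j$ (examples: the winner pays her own bid; the winner pays the second highest bid). $\mathbf{X}(\mathbf{b})=(X_1,\dots,X_n)$ denotes the resulting allocation, a partition of $[m]$.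 Utility: $u_i(\mathbf{b})=v_i(X_i)-\sum_{j\in X_i}p_j(\mathbf{b}_{[j]})$ if player $i$'s total payment does not exceed $c_i$, and $-\infty$ otherwise. A bid matrix $\mathbf{b}$ is a pure Nash equilibrium if $u_i(\mathbf{b})\ge u_i(\mathbf{y},\mathbf{b}_{-i})$ for every player $i$ and every bid vector $\mathbf{y}$, where $(\mathbf{y},\mathbf{b}_{-i})$ is $\mathbf{b}$ with $\mathbf{b}_i$ replaced by $\mathbf{y}$. $\mathrm{EQ}(\mathcal{G})$ is the set of equilibria of the game $\mathcal{G}$. Conservative behavior (standing assumption): the sum of bids a player submits for any bundle of items exceeds neither her value for this bundle nor her budget, that is, $\sum_{j\in X_i}b_{ij}\le\min\{v_i(X_i),c_i\}$. Liquid welfare: for an allocation $\mathbf{X}$ (a partition of $[m]$ among the players), $\mathrm{LW}(\mathbf{X})=\sum_{i\in[n]}\min\{v_i(X_i),c_i\}$. The pure liquid price of stability of an auction is $\mathrm{LPoS}=\sup_{\mathcal{G}}\frac{\max_{\mathbf{Y}}\mathrm{LW}(\mathbf{Y})}{\max_{\mathbf{b}\in\mathrm{EQ}(\mathcal{G})}\mathrm{LW}(\mathbf{X}(\mathbf{b}))}$, the supremum being over all games induced by the auction. *)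

(* Defs.v *)
From mathcomp Require Import all_boot all_order all_algebra.
From mathcomp Require Import all_classical all_reals all_analysis.
Import Order.TTheory GRing.Theory Num.Theory.
Import numFieldNormedType.Exports.

Set Implicit Arguments.
Unset Strict Implicit.
Unset Printing Implicit Defensive.

Local Open Scope ring_scope.

(* A game has [n.+1 >= 1] players and [m] items.  Bundles are finite sets of
   items; the value of the empty bundle is not normalised to 0. *)
Record game (R : realType) (n m : nat) := Game {
  value : 'I_n.+1 -> {set 'I_m} -> R;
  budget : 'I_n.+1 -> R;
  value_ge0 : forall i S, 0 <= value i S;
  budget_ge0 : forall i, 0 <= budget i
}.

Definition monotone_valuation (R : realType) (m : nat)
    (v : {set 'I_m} -> R) : Prop :=
  forall S T : {set 'I_m}, S \subset T -> v S <= v T.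

Definition subadditive_valuation (R : realType) (m : nat)
    (v : {set 'I_m} -> R) : Prop :=
  forall S T : {set 'I_m}, v (S :|: T) <= v S + v T.

Definition monotone_subadditive (R : realType) (m : nat)
    (v : {set 'I_m} -> R) : Prop :=
  monotone_valuation v /\ subadditive_valuation v.

Definition nonneg_mx (R : realType) (p q : nat) (b : 'M[R]_(p, q)) : Prop :=
  forall i j, 0 <= b i j.

(* An auction is a mechanism applicable to any number of players and items.
   Item [j] is sold on the basis of the column of bids for [j] alone:
   [winner j x] receives [j] and is charged [payment j x].  Ties are resolved
   by [winner], about which nothing more is assumed.  Only the values on
   nonnegative columns are meaningful. *)
Record auction (R : realType) := Auction {
  winner : forall n m : nat, 'I_m -> 'cV[R]_n.+1 -> 'I_n.+1;
  payment : forall n m : nat, 'I_m -> 'cV[R]_n.+1 -> R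
}.

Definition set_bid (R : realType) (n : nat) (x : 'cV[R]_n.+1)
    (i : 'I_n.+1) (t : R) : 'cV[R]_n.+1 :=
  \col_k (if k == i then t else x k 0).

Definition simple_auction (R : realType) (A : auction R) : Prop :=
  forall (n m : nat) (j : 'I_m) (x : 'cV[R]_n.+1), nonneg_mx x ->
  [/\ forall i, x i 0 <= x (winner A j x) 0,
      0 <= payment A j x <= x (winner A j x) 0,
      forall i (s t : R), 0 <= s -> s <= t ->
        payment A j (set_bid x i s) <= payment A j (set_bid x i t)
    & forall i, {within `[0%R, +oo[,
        continuous (fun t : R => payment A j (set_bid x i t))}%classic].

(* The coefficients may depend on the bids, as they do for the second-price
   rule. *)
Definition convex_auction (R : realType) (A : auction R) : Prop :=
  forall (n m : nat) (j : 'I_m) (x : 'cV[R]_n.+1), nonneg_mx x ->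
  exists w : 'I_n.+1 -> R,
    [/\ forall i, 0 <= w i,
        \sum_i w i = 1
      & payment A j x = \sum_i w i * x i 0].

(* An allocation is the function mapping each item to its owner. *)
Definition allocation (n m : nat) := {ffun 'I_m -> 'I_n.+1}.

Definition bundle (n m : nat) (X : allocation n m) (i : 'I_n.+1) : {set 'I_m} :=
  [set j | X j == i]%SET.

Definition outcome (R : realType) (A : auction R) (n m : nat)
    (b : 'M[R]_(n.+1, m)) : allocation n m :=
  [ffun j => winner A j (col j b)].

Definition total_payment (R : realType) (A : auction R) (n m : nat)
    (b : 'M[R]_(n.+1, m)) (i : 'I_n.+1) : R :=
  \sum_(j in bundle (outcome A b) i) payment A j (col j b).

Definition utility (R : realType) (A : auction R) (n m : nat)
    (G : game R n m) (b : 'M[R]_(n.+1, m)) (i : 'I_n.+1) : \bar R :=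
  if total_payment A b i <= budget G i
  then (value G i (bundle (outcome A b) i) - total_payment A b i)%:E
  else -oo%E.

Definition deviate (R : realType) (n m : nat) (b : 'M[R]_(n.+1, m))
    (i : 'I_n.+1) (y : 'rV[R]_m) : 'M[R]_(n.+1, m) :=
  \matrix_(k, j) (if k == i then y 0 j else b k j).

Definition pure_nash (R : realType) (A : auction R) (n m : nat)
    (G : game R n m) (b : 'M[R]_(n.+1, m)) : Prop :=
  forall (i : 'I_n.+1) (y : 'rV[R]_m), nonneg_mx y ->
    (utility A G (deviate b i y) i <= utility A G b i)%E.

Definition conservative (R : realType) (n m : nat)
    (G : game R n m) (b : 'M[R]_(n.+1, m)) : Prop :=
  forall (i : 'I_n.+1) (S : {set 'I_m}),
    \sum_(j in S) b i j <= Num.min (value G i S) (budget G i).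

(* Equilibria are conservative, but they have to be immune to all deviations,
   conservative or not. *)
Definition EQ (R : realType) (A : auction R) (n m : nat) (G : game R n m) :
    set 'M[R]_(n.+1, m) :=
  [set b | [/\ nonneg_mx b, conservative G b & pure_nash A G b]]%classic.

Definition LW (R : realType) (n m : nat) (G : game R n m)
    (X : allocation n m) : R :=
  \sum_i Num.min (value G i (bundle X i)) (budget G i).

(* There are finitely many allocations, so both suprema below are maxima as
   soon as they range over nonempty sets. *)
Definition optimal_LW (R : realType) (n m : nat) (G : game R n m) : \bar R :=
  ereal_sup [set (LW G Y)%:E | Y in [set: allocation n m]]%classic.

Definition best_equilibrium_LW (R : realType) (A : auction R) (n m : nat)
    (G : game R n m) : \bar R :=
  ereal_sup [set (LW G (outcome A b))%:E | b in EQ A G]%classic.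

(* The pure liquid price of stability of [A] over the games all of whose
   valuations belong to [V].  Games without equilibrium define no ratio and are
   left out.  In [\bar R], [x / 0 = +oo] for [x > 0] and [0 / 0 = 0], so a
   game with [optimal_LW G = 0] does not affect the supremum. *)
Definition LPoS (R : realType) (A : auction R)
    (V : forall m : nat, ({set 'I_m} -> R) -> Prop) : \bar R :=
  ereal_sup [set r : \bar R | exists (n m : nat) (G : game R n m),
    [/\ forall i, V m (value G i),
        (EQ A G !=set0)%classic
      & r = (optimal_LW G / best_equilibrium_LW A G)%E]]%classic.

(* Main.v *)
Require Import Defs.
From mathcomp Require Import all_boot all_order all_algebra.
From mathcomp Require Import all_classical all_reals all_analysis.
From mathcomp Require Import lra.
Local Open Scope ring_scope.

(** Upper bound: let [b] be an equilibrium with outcome [X] and let [Y] be any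
    allocation. Player [i] can win [Y_i] by bidding slightly more than the
    highest bids on it. Either the highest bids on [Y_i] exhaust her budget, or
    this deviation is affordable and must not be profitable; in both cases
    [min(v_i(Y_i), c_i) <= min(v_i(X_i), c_i) + (highest bids on Y_i)].
    Summing over [i], the highest bids add up to at most [LW(X)] since bids are
    conservative, hence [LW(Y) <= 2 LW(X)].

    Lower bound: two players, two items, budgets 1. Let [a] be the player whom
    the auction favours when both bid 1 for item 0. Player [a] has value 3 for
    any bundle with item 0 and 1 for item 1 alone; the other player has value 1
    for item 0 only. In every equilibrium [a] wins item 0, and the liquid welfare
    is 1 although 2 is possible. Both players bidding 1 for item 0 and 0 for
    item 1 is an equilibrium: by convexity nobody wins item 0 for less than 1. *)

Import Order.TTheory GRing.Theory Num.Theory.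

Set Implicit Arguments.
Unset Strict Implicit.
Unset Printing Implicit Defensive.

(** * Winners and payments in a simple auction, and the upper bound *)

Section SimpleAuction.
Variables (R : realType) (A : auction R).
Hypothesis hS : simple_auction A.

Lemma nonneg_col n m (b : 'M[R]_(n, m)) j : nonneg_mx b -> nonneg_mx (col j b).
Proof. by move=> hb i k; rewrite mxE. Qed.

Lemma nonneg_deviate n m (b : 'M[R]_(n.+1, m)) i y :
  nonneg_mx b -> nonneg_mx y -> nonneg_mx (deviate b i y).
Proof. by move=> hb hy k j; rewrite mxE; case: ifP. Qed.

Lemma le_winner n m (j : 'I_m) (x : 'cV[R]_n.+1) i :
  nonneg_mx x -> x i 0 <= x (winner A j x) 0.
Proof. by move=> /(hS j)[]. Qed.

Lemma payment_bounds n m (j : 'I_m) (x : 'cV[R]_n.+1) :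
  nonneg_mx x -> 0 <= payment A j x <= x (winner A j x) 0.
Proof. by move=> /(hS j)[]. Qed.

(** Ties are broken arbitrarily, so a deviating player is sure of an item only by strictly
    outbidding everyone else. *)
Lemma strict_winner n m (j : 'I_m) (x : 'cV[R]_n.+1) i : nonneg_mx x ->
  (forall k, k != i -> x k 0 < x i 0) -> winner A j x = i.
Proof.
move=> hx hi; apply/eqP/negPn/negP => /hi.
by rewrite ltNge le_winner.
Qed.

Lemma total_payment_ge0 n m (b : 'M[R]_(n.+1, m)) i :
  nonneg_mx b -> 0 <= total_payment A b i.
Proof.
move=> hb; apply: sumr_ge0 => j _.
by case/andP: (payment_bounds j (nonneg_col j hb)).
Qed.

Lemma total_payment_le_bids n m (b : 'M[R]_(n.+1, m)) i : nonneg_mx b ->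
  total_payment A b i <= \sum_(j in bundle (outcome A b) i) b i j.
Proof.
move=> hb; apply: ler_sum => j; rewrite inE ffunE => /eqP hj.
by case/andP: (payment_bounds j (nonneg_col j hb)) => _; rewrite hj mxE.
Qed.

(** Read off at the winner, so that conservativeness bounds its sum over each won bundle. *)
Definition top_bid n m (b : 'M[R]_(n.+1, m)) (j : 'I_m) : R :=
  b (outcome A b j) j.

Lemma le_top_bid n m (b : 'M[R]_(n.+1, m)) i j :
  nonneg_mx b -> b i j <= top_bid b j.
Proof.
move=> hb; have := le_winner j i (nonneg_col j hb).
by rewrite /top_bid ffunE !mxE.
Qed.

Lemma utility_le_value n m (G : game R n m) (b : 'M[R]_(n.+1, m)) i :
  nonneg_mx b ->
  (utility A G b i <= (value G i (bundle (outcome A b) i))%:E)%E.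
Proof.
move=> hb; rewrite /utility; case: ifP => _; last exact: leNye.
by rewrite lee_fin gerBl total_payment_ge0.
Qed.

Lemma sum_bundle n m (X : allocation n m) (f : 'I_m -> R) :
  \sum_i \sum_(j in bundle X i) f j = \sum_j f j.
Proof.
rewrite [RHS](partition_big X xpredT) //=.
by apply: eq_bigr => i _; apply: eq_bigl => j; rewrite inE.
Qed.

Lemma deviation_bound n m (G : game R n m) (b : 'M[R]_(n.+1, m)) i
    (S : {set 'I_m}) :
  monotone_valuation (value G i) -> EQ A G b ->
  Num.min (value G i S) (budget G i) <=
  Num.min (value G i (bundle (outcome A b) i)) (budget G i)
    + \sum_(j in S) top_bid b j.
Proof.
move=> hmon [hb hc hN]; rewrite leNgt; apply/negP => hlt.
set X := bundle (outcome A b) i in hlt.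
set M := \sum_(j in S) top_bid b j in hlt.
have M0 : 0 <= M by apply: sumr_ge0 => j _; apply: hb.
have V0 := value_ge0 G i X; have c0 := budget_ge0 G i.
(* The slack in the budget and in the gain from deviating. Since [0 <= M], [hlt] forces
   [value G i X < budget G i], which makes both positive. *)
pose d := Num.min (budget G i - M) (value G i S - value G i X - M).
have d0 : 0 < d.
  rewrite /d lt_min !subr_gt0; move: hlt.
  rewrite /Num.min.
  case: (ltP (value G i S)) => ?; case: (ltP (value G i X)) => ? ?;
    by apply/andP; split; lra.
(* At most [m] bids are raised by [e], so dividing by [m.+1] keeps the total increase strictly below
   [d]. *)
pose e := d / m.+1%:R.
have e0 : 0 < e by rewrite divr_gt0.
pose y : 'rV[R]_m := \row_j (if j \in S then top_bid b j + e else 0).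
have hy : nonneg_mx y.
  move=> k j; rewrite mxE; case: ifP => // _.
  by rewrite addr_ge0 ?(ltW e0) ?hb.
have hb' := nonneg_deviate i hb hy.
have hsub : S \subset bundle (outcome A (deviate b i y)) i.
  apply/fintype.subsetP => j jS; rewrite inE ffunE; apply/eqP.
  apply: strict_winner; first exact: nonneg_col.
  move=> k /negbTE ki; rewrite !mxE ki eqxx jS.
  by apply: le_lt_trans (le_top_bid k j hb) _; rewrite ltrDl.
have hsum : \sum_j y 0 j < M + d.
  rewrite (eq_bigr (fun j => if j \in S then top_bid b j + e else 0)); last first.
    by move=> j _; rewrite mxE.
  rewrite -big_mkcond big_split /= ltrD2l sumr_const.
  rewrite -mulr_natr /e mulrAC ltr_pdivrMr ?ltr0n // ltr_pM2l // ltr_nat ltnS.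
  by apply: leq_trans (max_card _) _; rewrite card_ord.
(* Zero bids may win further items in ties, but these cost nothing and, by monotonicity, do not
   lower the value. *)
have hpay : total_payment A (deviate b i y) i <= \sum_j y 0 j.
  apply: le_trans (total_payment_le_bids _ hb') _.
  rewrite big_mkcond; apply: ler_sum => j _.
  by case: ifP => _; [rewrite mxE eqxx | exact: hy].
have hdc : d <= budget G i - M by rewrite ge_min lexx.
have hdv : d <= value G i S - value G i X - M by rewrite ge_min lexx orbT.
have := le_trans (hN i y hy) (utility_le_value G i hb).
rewrite /utility ifT; last by lra.
rewrite lee_fin -/X; have := hmon _ _ hsub; lra.
Qed.

Lemma LW_le_twice_equilibrium n m (G : game R n m) (b : 'M[R]_(n.+1, m)) Y :
  (forall i, monotone_valuation (value G i)) -> EQ A G b ->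
  LW G Y <= 2 * LW G (outcome A b).
Proof.
move=> hmon hE; case: (hE) => _ hc _.
apply: (@le_trans _ _ (LW G (outcome A b) + \sum_j top_bid b j)).
  rewrite -(sum_bundle Y) -big_split /=.
  by apply: ler_sum => i _; apply: deviation_bound.
rewrite mulr_natl mulr2n lerD2l -(sum_bundle (outcome A b)).
apply: ler_sum => i _; apply: le_trans (hc i _).
by apply: ler_sum => j; rewrite inE /top_bid => /eqP ->.
Qed.

Lemma LW_ge0 n m (G : game R n m) Y : 0 <= LW G Y.
Proof.
by apply: sumr_ge0 => i _; rewrite le_min value_ge0 budget_ge0.
Qed.

Lemma LPoS_le2 : (LPoS A (@monotone_subadditive R) <= 2%:E)%E.
Proof.
apply: ge_ereal_sup => _ [n [m [G [hV [b hE] ->]]]].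
have hmon i : monotone_valuation (value G i) by case: (hV i).
have hopt : (optimal_LW G <= (2 * LW G (outcome A b))%:E)%E.
  by apply: ge_ereal_sup => _ [Y _ <-]; rewrite lee_fin LW_le_twice_equilibrium.
have hbest : ((LW G (outcome A b))%:E <= best_equilibrium_LW A G)%E.
  by apply: ereal_sup_ubound; exists b.
have hopt0 : (0 <= optimal_LW G)%E.
  apply: (@le_trans _ _ (LW G (outcome A b))%:E); first by rewrite lee_fin LW_ge0.
  by apply: ereal_sup_ubound; exists (outcome A b).
(* [hbest] excludes [-oo]; at [+oo] the inverse, hence the ratio, is 0. *)
case: (best_equilibrium_LW A G) hbest => [r||] //; last first.
  by move=> _; rewrite invey mule0 lee_fin.
rewrite lee_fin => hr; have r_ge0 := le_trans (LW_ge0 G (outcome A b)) hr.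
(* A zero denominator forces a zero optimum, and [0 / 0] counts as 0. *)
have [r0|r0] := ltP 0 r; last first.
  have -> : optimal_LW G = 0%E.
    apply/eqP; rewrite eq_le hopt0 andbT; apply: le_trans hopt _.
    by rewrite lee_fin; lra.
  by rewrite mul0e lee_fin.
rewrite inver gt_eqF // lee_pdivrMr // -EFinM.
by apply: le_trans hopt _; rewrite lee_fin; lra.
Qed.

End SimpleAuction.

(** * Lower bound: a two-player game with ratio 2 *)

Section LowerBound.
Variables (R : realType) (A : auction R).
Hypotheses (hS : simple_auction A) (hconv : convex_auction A).

Lemma convex_payment_ge n m (j : 'I_m) (x : 'cV[R]_n.+1) t : nonneg_mx x ->
  (forall i, t <= x i 0) -> t <= payment A j x.
Proof.
move=> hx ht; have [w [w0 w1 ->]] := hconv j hx.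
rewrite -[t]mul1r -w1 mulr_suml.
by apply: ler_sum => i _; apply: ler_wpM2l.
Qed.

Definition item0 : 'I_2 := ord0.
Definition item1 : 'I_2 := ord_max.

Lemma rev_ord2 (i : 'I_2) : rev_ord i != i.
Proof. by case: i => [[|[|]]]. Qed.

Lemma ord2_neq (i k : 'I_2) : k != i -> k = rev_ord i.
Proof.
by move=> ki; apply: val_inj; case: i k ki => [[|[|//]] ?] [[|[|//]] ?].
Qed.

Definition favoured : 'I_2 := winner A item0 (const_mx 1 : 'cV[R]_2).

(** With value 3, winning item 0 for at most 1 leaves [favoured] at least 2, more than item 1 alone
    is worth; liquid welfare still caps this value at the budget 1. *)
Definition tight_value (i : 'I_2) (S : {set 'I_2}) : R :=
  if item0 \in S then (if i == favoured then 3 else 1)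
  else if (i == favoured) && (item1 \in S) then 1 else 0.

Lemma tight_value_ge0 i S : 0 <= tight_value i S.
Proof. by rewrite /tight_value; do !case: ifP. Qed.

Definition tight_game : game R 1 2 :=
  Game tight_value_ge0 (fun=> ler01 : 0 <= 1).

Lemma tight_value_monotone_subadditive i :
  monotone_subadditive (tight_value i).
Proof.
split=> S T; last first.
  rewrite /tight_value !inE.
  by case: (i == _); case: (_ \in S); case: (_ \in T);
     case: (_ \in S); case: (_ \in T) => /=; lra.
move=> /fintype.subsetP hST; rewrite /tight_value.
have := hST item0; have := hST item1.
case: (i == _); case: (_ \in S); case: (_ \in T);
  case: (_ \in S); case: (_ \in T) => //= h1 h2; try lra;
  by have := h1 isT; have := h2 isT.
Qed.

Definition tight_bids : 'M[R]_(2, 2) :=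
  \matrix_(i, j) (if j == item0 then 1 else 0).

Lemma nonneg_tight_bids : nonneg_mx tight_bids.
Proof. by move=> i j; rewrite mxE; case: ifP. Qed.

Lemma col_tight_bids : col item0 tight_bids = const_mx 1.
Proof. by apply/matrixP => i j; rewrite !mxE. Qed.

Lemma total_payment_item0 n (b : 'M[R]_(n.+1, 2)) i t : nonneg_mx b ->
  item0 \in bundle (outcome A b) i -> (forall k, t <= b k item0) ->
  t <= total_payment A b i.
Proof.
move=> hb h0 ht; rewrite /total_payment (bigD1 item0) //=.
rewrite -[t]addr0 lerD //.
  apply: convex_payment_ge; first exact: nonneg_col.
  by move=> k; rewrite mxE.
apply: sumr_ge0 => j _.
by case/andP: (payment_bounds hS j (nonneg_col j hb)).
Qed.

Lemma tight_bids_EQ : EQ A tight_game tight_bids.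
Proof.
have hb := nonneg_tight_bids.
have hout i : (item0 \in bundle (outcome A tight_bids) i) = (i == favoured).
  by rewrite inE ffunE col_tight_bids eq_sym.
have hcons : conservative tight_game tight_bids.
  move=> i S /=; rewrite big_mkcond big_ord_recl big_ord1 !mxE /=.
  rewrite (_ : lift ord0 ord0 = item1); last exact: val_inj.
  rewrite /tight_value -/item0 /Num.min.
  by case: (item0 \in S); case: (item1 \in S); case: (i == _);
     rewrite /=; case: ltP => ?; lra.
split=> // i y hy.
have hb' := nonneg_deviate i hb hy.
have hpay : total_payment A tight_bids i <= if i == favoured then 1 else 0.
  apply: le_trans (total_payment_le_bids hS i hb) _.
  rewrite big_mkcond big_ord_recl big_ord1 -/item0 hout !mxE /=.
  by case: (i == _); case: ifP => _; lra.
have hub : (((if i == favoured then 2 else 0) : R)%:E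
    <= utility A tight_game tight_bids i)%E.
  have -> : utility A tight_game tight_bids i =
      (tight_value i (bundle (outcome A tight_bids) i)
         - total_payment A tight_bids i)%:E.
    by rewrite /utility ifT //=; apply: le_trans hpay _; case: (i == _).
  rewrite lee_fin /tight_value hout; move: hpay.
  by case: (i == _) => /= ?; lra.
apply: le_trans hub; rewrite /utility; case: ifP => _; last exact: leNye.
rewrite lee_fin /= /tight_value.
have p0 := total_payment_ge0 hS i hb'.
(* Without item 0 the deviation yields at most 1 for [favoured] and 0 for the opponent, within the
   bounds 2 and 0 of [hub]. With item 0, a price of at least 1 suffices. *)
case: ifP => h0; last by case: (i == _) => /=; [case: ifP => _|]; lra.
suff : 1 <= total_payment A (deviate tight_bids i y) i.
  by case: (i == _); lra.
(* the winner of item 0 bids at least as much as the opponent, who bids 1 *)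
apply: total_payment_item0 => // k; rewrite mxE.
case: eqP => [_|_]; last by rewrite mxE.
have := le_top_bid hS (rev_ord i) item0 hb'.
rewrite /top_bid; move: h0; rewrite inE => /eqP ->.
by rewrite !mxE (negbTE (rev_ord2 i)) !eqxx.
Qed.

(** Otherwise [favoured] has value at most 1, while bidding 1 for item 0 and 0 for item 1 would
    yield at least 2. *)
Lemma equilibrium_favoured b : EQ A tight_game b ->
  item0 \in bundle (outcome A b) favoured.
Proof.
move=> [hb hc hN]; apply/negPn/negP => h0.
pose y : 'rV[R]_2 := \row_j (if j == item0 then 1 else 0).
have hy : nonneg_mx y by move=> k j; rewrite mxE; case: ifP.
have hb' := nonneg_deviate favoured hb hy.
have ble k : b k item0 <= 1.
  have := hc k [set item0]%SET; rewrite big_set1 /=.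
  by rewrite le_min => /andP[].
have hwin : item0 \in bundle (outcome A (deviate b favoured y)) favoured.
  rewrite inE ffunE; apply/eqP.
  (* The opponent bids at most 1: either exactly 1, the tie that defines [favoured], or less, and
     [favoured] wins strictly. *)
  have [heq|[k kf]] : col item0 (deviate b favoured y) = const_mx 1 \/
      exists2 k, k != favoured & b k item0 < 1.
    have [h|h] := pselect (exists2 k, k != favoured & b k item0 < 1).
      by right.
    left; apply/matrixP => k l; rewrite !mxE.
    case: eqP => [//|/eqP kf]; apply/eqP; rewrite eq_le ble /= leNgt.
    by apply/negP => ?; apply: h; exists k.
  - by rewrite heq.
  - move=> bk; apply: (strict_winner hS); first exact: nonneg_col.
    move=> l lf; rewrite !mxE (negbTE lf) !eqxx.
    by rewrite (ord2_neq lf) -(ord2_neq kf).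
have hpay : total_payment A (deviate b favoured y) favoured <= 1.
  apply: le_trans (total_payment_le_bids hS _ hb') _.
  rewrite big_mkcond big_ord_recl big_ord1 !mxE !eqxx /= -/item0 hwin.
  by case: ifP => _; lra.
have := le_trans (hN favoured y hy) (utility_le_value hS tight_game favoured hb).
rewrite /utility ifT // lee_fin /= /tight_value hwin (negbTE h0) eqxx /=.
by case: ifP => _; lra.
Qed.

Lemma sum_favoured (f : 'I_2 -> R) :
  \sum_i f i = f favoured + f (rev_ord favoured).
Proof.
rewrite big_ord_recl big_ord1 (_ : lift ord0 ord0 = item1); last exact: val_inj.
case: favoured => [[|[|]]] // h.
  by congr (f _ + f _); exact: val_inj.
by rewrite addrC; congr (f _ + f _); exact: val_inj.
Qed.

(** [favoured] contributes [min(3, 1)], and the opponent can get only item 1, which is worthless to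
    her. *)
Lemma equilibrium_LW b : EQ A tight_game b -> LW tight_game (outcome A b) = 1.
Proof.
move=> /equilibrium_favoured h0.
rewrite /LW sum_favoured /= /tight_value h0 eqxx (negbTE (rev_ord2 _)) /=.
rewrite ifF; last by move: h0; rewrite !inE => /eqP ->; rewrite eq_sym (negbTE (rev_ord2 _)).
by rewrite /Num.min; case: ltP => ?; case: ltP => ?; lra.
Qed.

Lemma best_equilibrium_tight : best_equilibrium_LW A tight_game = 1%E.
Proof.
apply/eqP; rewrite eq_le; apply/andP; split.
  by apply: ge_ereal_sup => _ [b hE <-]; rewrite equilibrium_LW.
apply: ereal_sup_ubound; exists tight_bids; first exact: tight_bids_EQ.
by rewrite equilibrium_LW //; exact: tight_bids_EQ.
Qed.

Lemma optimal_tight_ge2 : (2%:E <= optimal_LW tight_game)%E.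
Proof.
(* Item 0 goes to the opponent and item 1 to [favoured]: each contributes 1. *)
pose Y : allocation 1 2 :=
  [ffun j => if j == item0 then rev_ord favoured else favoured].
have -> : 2 = LW tight_game Y.
  rewrite /LW sum_favoured /= /tight_value !inE !ffunE !eqxx /=.
  by rewrite (negbTE (rev_ord2 _)) minxx.
by apply: ereal_sup_ubound; exists Y.
Qed.

Lemma LPoS_ge2 : (2%:E <= LPoS A (@monotone_subadditive R))%E.
Proof.
apply: le_trans optimal_tight_ge2 _; apply: ereal_sup_ubound.
exists 1%N, 2%N, tight_game; split.
- exact: tight_value_monotone_subadditive.
- by exists tight_bids; exact: tight_bids_EQ.
- by rewrite best_equilibrium_tight inve1 mule1.
Qed.

End LowerBound.

Theorem corollary5 (R : realType) (A : auction R)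
    (hS : simple_auction A) (hconv : convex_auction A) :
  LPoS A (@monotone_subadditive R) = 2%:E.
Proof. by apply/eqP; rewrite eq_le LPoS_le2 // LPoS_ge2. Qed.
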